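(* For every positive integer $n$, $\Psi(Q_n)\le \Psi(Q_{n+1})\le \Psi(Q_n)+1$.
   Context: $Q_n$ is the $n$-dimensional hypercube: vertex set $\{0,1\}^n$, two vertices adjacent iff they differ in exactly one coordinate. A set $S$ of vertices of a graph $G$ is doubly resolving if for all distinct vertices $u,v$ there are $x,y\in S$ with $d_G(u,x)-d_G(u,y)\neq d_G(v,x)-d_G(v,y)$; $\Psi(G)$ is the minimum cardinality of a doubly resolving set. *)

(* Defs.v *)
From mathcomp Require Import all_boot all_order all_algebra.
Set Implicit Arguments.
Unset Strict Implicit.
Unset Printing Implicit Defensive.
Import GRing.Theory.

Section GraphDistance.
Variables (T : finType) (e : rel T).

Definition has_walk (x y : T) (k : nat) : bool :=
  [exists p : k.-tuple T, path e x p && (last x p == y)].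

(* Length of a shortest walk from x to y. A shortest walk repeats no vertex,
   so the search below #|T| is exhaustive; if y is not reachable from x, the
   value is #|T|. *)
Definition gdist (x y : T) : nat := find (has_walk x y) (iota 0 #|T|).

(* The differences of distances are taken in int. *)
Definition doubly_resolving (S : {set T}) : bool :=
  [forall u, forall v, (u != v) ==>
    [exists x in S, exists y in S,
      ((gdist u x)%:Z - (gdist u y)%:Z != (gdist v x)%:Z - (gdist v y)%:Z)%R]].

(* [arg min_(S < S0 | P S) ...] is a minimum only when P S0 holds; here S0 is
   the whole vertex set, see doubly_resolvingT. *)
Definition Psi : nat :=
  #|[arg min_(S < [set: T] | doubly_resolving S) #|S|]|.

Lemma gdistP x y : connect e x y ->
  has_walk x y (gdist x y) /\ forall k, has_walk x y k -> gdist x y <= k.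
Proof.
move=> /connectP[p0 ep0 ->]; case/shortenP: ep0 => p ep up _ {p0}.
set y' := last x p.
have hw : has_walk x y' (size p).
  by apply/existsP; exists (in_tuple p); rewrite ep eqxx.
have szp : size p < #|T| by rewrite (leq_trans _ (max_card (mem (x :: p)))) // (card_uniqP up).
have hs : has (has_walk x y') (iota 0 #|T|).
  by apply/hasP; exists (size p); rewrite // mem_iota.
split=> [|k hk].
  have lt : gdist x y' < #|T| by rewrite -[X in _ < X](size_iota 0) -has_find.
  by have := nth_find 0 hs; rewrite nth_iota.
rewrite leqNgt; apply/negP => lt.
have ltT : k < #|T|.
  by apply: leq_trans lt _; rewrite -[X in _ <= X](size_iota 0) find_size.
by have := before_find 0 lt; rewrite nth_iota // hk.
Qed.

Lemma gdist_eq0 x y : (gdist x y == 0) = (x == y).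
Proof.
rewrite /gdist; have : 0 < #|T| by apply/card_gt0P; exists x.
case: #|T| => // m _ /=.
have -> : has_walk x y 0 = (x == y).
  apply/existsP/idP => [[p]|xy]; first by rewrite (tuple0 p).
  by exists [tuple].
by case: (x == y).
Qed.

Lemma doubly_resolvingT : doubly_resolving [set: T].
Proof.
apply/forallP => u; apply/forallP => v; apply/implyP => uv.
apply/existsP; exists u; rewrite in_setT; apply/existsP; exists v; rewrite in_setT /=.
have /eqP-> : gdist u u == 0 by rewrite gdist_eq0.
have /eqP-> : gdist v v == 0 by rewrite gdist_eq0.
have vu : 0 < gdist v u by rewrite lt0n gdist_eq0 eq_sym.
have {}uv : 0 < gdist u v by rewrite lt0n gdist_eq0.
by rewrite sub0r subr0; case: (gdist u v) uv; case: (gdist v u) vu.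
Qed.

Lemma PsiP :
  (exists2 S : {set T}, doubly_resolving S & #|S| = Psi) /\
  forall S : {set T}, doubly_resolving S -> Psi <= #|S|.
Proof.
rewrite /Psi; case: arg_minnP; first exact: doubly_resolvingT.
by move=> S dS minS; split; first exists S.
Qed.

End GraphDistance.

Definition hypercube (n : nat) : rel {ffun 'I_n -> bool} :=
  fun u v => #|[set i | u i != v i]| == 1.

(* Main.v *)
Require Import Defs.
From mathcomp Require Import all_boot all_order all_algebra.
From mathcomp Require Import zify.
Set Implicit Arguments.
Unset Strict Implicit.
Unset Printing Implicit Defensive.

(** Distances in the hypercube are Hamming distances, so splitting off one
    coordinate adds to [d(u, x)] a term depending only on that coordinate of
    [u] and [x].  Hence the projection to [Q_n] of a doubly resolving set of
    [Q_(n+1)] is doubly resolving: lift [u], [v] with the same extra coordinate.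
    Conversely, if [S] is doubly resolving in [Q_n], then [S * {0}] separates
    all pairs that differ in [Q_n], and one further vertex with extra coordinate
    [1] separates [(u, 0)] from [(u, 1)]. *)

(** Moving the subtracted distances across the inequality trades integer differences for sums in
    [nat], a form that survives rewriting by [hamming_cons] and suits [lia]. *)
Lemma doubly_resolvingP (T : finType) (e : rel T) (S : {set T}) :
  reflect (forall u v, u != v -> exists x y, [/\ x \in S, y \in S &
             gdist e u x + gdist e v y != gdist e v x + gdist e u y])
          (doubly_resolving e S).
Proof.
apply: (iffP forallP) => [dS u v uv | dS u].
  have /forallP/(_ v)/implyP/(_ uv)/exists_inP[x xS /exists_inP[y yS nexy]] := dS u.
  by exists x, y; split=> //; lia.
apply/forallP => v; apply/implyP => /dS[x [y [xS yS nexy]]].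
by apply/exists_inP; exists x => //; apply/exists_inP; exists y => //; lia.
Qed.

Definition hamming n (u v : {ffun 'I_n -> bool}) : nat := \sum_i (u i != v i).

Lemma hamming_card n (u v : {ffun 'I_n -> bool}) :
  hamming u v = #|[set i | u i != v i]|.
Proof.
by rewrite -sum1_card [RHS]big_mkcond; apply: eq_bigr => i _; rewrite inE; case: ifP.
Qed.

Lemma hypercubeE n (u v : {ffun 'I_n -> bool}) :
  hypercube u v = (hamming u v == 1).
Proof. by rewrite hamming_card. Qed.

Lemma hamming_eq0 n (u v : {ffun 'I_n -> bool}) : (hamming u v == 0) = (u == v).
Proof.
rewrite /hamming sum_nat_eq0; apply/idP/eqP => [/forallP uv | ->]; last first.
  by apply/forallP => i; rewrite eqxx.
by apply/ffunP => i; apply/eqP; have := uv i; rewrite eqb0 negbK.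
Qed.

Lemma hamming_triangle n (v u w : {ffun 'I_n -> bool}) :
  hamming u w <= hamming u v + hamming v w.
Proof.
rewrite /hamming -big_split; apply: leq_sum => i _ /=.
by case: (u i) (v i) (w i) => [] [] [].
Qed.

(** Each edge covers Hamming distance 1, so the triangle inequality bounds the length of any walk
    from below. *)
Lemma hamming_path n (u : {ffun 'I_n -> bool}) p :
  path (@hypercube n) u p -> hamming u (last u p) <= size p.
Proof.
elim: p u => [|v p IHp] u /=; first by move=> _; rewrite leqn0 hamming_eq0.
rewrite hypercubeE => /andP[/eqP uv /IHp vp].
by rewrite (leq_trans (hamming_triangle v u _)) // uv.
Qed.

(** The lower bound is attained by correcting the differing coordinates one at a time. *)
Lemma has_walk_hamming n (u v : {ffun 'I_n -> bool}) :
  has_walk (@hypercube n) u v (hamming u v).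
Proof.
have [k def_k] : exists k, k = hamming u v by exists (hamming u v).
rewrite -def_k; elim: k u def_k => [|k IHk] u def_k.
  by apply/existsP; exists [tuple]; rewrite /= -hamming_eq0 -def_k.
have [i uvi] : exists i, u i != v i.
  apply/existsP; rewrite -negb_forall; apply: contraTN (ltn0Sn k) => /forallP uv.
  by rewrite def_k /hamming big1 // => i _; rewrite uv.
(* The first vertex of the walk: [u] with its wrong coordinate [i] flipped, hence one step closer to
   [v]. *)
pose w := [ffun j => if j == i then v j else u j].
have uw : hamming u w = 1.
  rewrite /hamming (bigD1 i) //= ffunE eqxx uvi big1 // => j /negbTE ji.
  by rewrite ffunE ji eqxx.
have wv : k = hamming w v.
  apply: succn_inj; rewrite def_k /hamming (bigD1 i) //= uvi add1n; congr _.+1.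
  rewrite [RHS](bigD1 i) //= ffunE !eqxx add0n.
  by apply: eq_bigr => j /negbTE ji; rewrite ffunE ji.
have /existsP[p /andP[wp pv]] := IHk _ wv.
by apply/existsP; exists [tuple of w :: p]; rewrite /= hypercubeE uw eqxx wp.
Qed.

Lemma gdist_hypercube n (u v : {ffun 'I_n -> bool}) :
  gdist (@hypercube n) u v = hamming u v.
Proof.
have uv : connect (@hypercube n) u v.
  have /existsP[p /andP[up /eqP <-]] := has_walk_hamming u v.
  by apply/connectP; exists p.
have [/existsP[p /andP[up /eqP pv]] min_uv] := gdistP uv.
apply/eqP; rewrite eqn_leq min_uv ?has_walk_hamming //=.
by have := hamming_path up; rewrite pv size_tuple.
Qed.

Definition cube_cons n (b : bool) (u : {ffun 'I_n -> bool}) : {ffun 'I_n.+1 -> bool} :=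
  [ffun i => if unlift ord0 i is Some j then u j else b].

Definition cube_tail n (u : {ffun 'I_n.+1 -> bool}) : {ffun 'I_n -> bool} :=
  [ffun i => u (lift ord0 i)].

Lemma cube_consK n (u : {ffun 'I_n.+1 -> bool}) : cube_cons (u ord0) (cube_tail u) = u.
Proof.
by apply/ffunP => i; rewrite ffunE; case: unliftP => [j|] ->; rewrite ?ffunE.
Qed.

Lemma hamming_cons n (a b : bool) (u v : {ffun 'I_n -> bool}) :
  hamming (cube_cons a u) (cube_cons b v) = (a != b) + hamming u v.
Proof.
rewrite /hamming big_ord_recl !ffunE unlift_none; congr (_ + _).
by apply: eq_bigr => i _; rewrite !ffunE liftK.
Qed.

Lemma cube_cons_inj n (b : bool) : injective (@cube_cons n b).
Proof.
move=> u v uv; apply/eqP; rewrite -hamming_eq0.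
by have /eqP := uv; rewrite -hamming_eq0 hamming_cons eqxx.
Qed.

Lemma doubly_resolving_tail n (S : {set {ffun 'I_n.+1 -> bool}}) :
  doubly_resolving (@hypercube n.+1) S ->
  doubly_resolving (@hypercube n) (@cube_tail n @: S).
Proof.
move=> /doubly_resolvingP dS; apply/doubly_resolvingP => u v uv.
have [|x [y [xS yS]]] := dS (cube_cons false u) (cube_cons false v).
  by rewrite (inj_eq (@cube_cons_inj _ _)).
(* The terms from the extra coordinates of [x] and [y] now occur on both sides and cancel. *)
rewrite !gdist_hypercube -(cube_consK x) -(cube_consK y) !hamming_cons => nexy.
exists (cube_tail x), (cube_tail y); rewrite !imset_f //; split=> //.
by rewrite !gdist_hypercube; lia.
Qed.

(** For [0 < n] there are two distinct vertices to separate. In the one-vertex cube [n = 0] even the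
    empty set is doubly resolving. *)
Lemma doubly_resolving_neq0 n (S : {set {ffun 'I_n -> bool}}) :
  0 < n -> doubly_resolving (@hypercube n) S -> exists s, s \in S.
Proof.
case: n S => // n S _ /doubly_resolvingP dS.
have [|x [_ [xS _ _]]] := dS [ffun=> true] [ffun=> false]; last by exists x.
by apply/eqP => /ffunP/(_ ord0); rewrite !ffunE.
Qed.

Lemma doubly_resolving_cons n (S : {set {ffun 'I_n -> bool}}) s :
  s \in S -> doubly_resolving (@hypercube n) S ->
  doubly_resolving (@hypercube n.+1) (cube_cons true s |: cube_cons false @: S).
Proof.
move=> sS /doubly_resolvingP dS; apply/doubly_resolvingP => u v.
rewrite -(cube_consK u) -(cube_consK v).
move: (u ord0) (v ord0) (cube_tail u) (cube_tail v) => a b {}u {}v neq_uv.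
have [eq_uv | /dS[x [y [xS yS nexy]]]] := eqVneq u v; last first.
  exists (cube_cons false x), (cube_cons false y).
  rewrite !inE !imset_f ?orbT //; split=> //.
  by move: nexy; rewrite !gdist_hypercube !hamming_cons; lia.
(* These two vertices differ only in the extra coordinate, so the distance to the first minus that
   to the second is -1 or 1 according to whether [a] (resp. [b]) is [true] or [false]. *)
exists (cube_cons true s), (cube_cons false s).
rewrite !inE eqxx imset_f ?orbT //; split=> //.
rewrite !gdist_hypercube !hamming_cons eq_uv.
by case: a b neq_uv => [] []; rewrite eq_uv ?eqxx // => _; lia.
Qed.

Theorem theorem9 (n : nat) (hn : 0 < n) :
  Psi (@hypercube n) <= Psi (@hypercube n.+1) <= (Psi (@hypercube n)).+1.
Proof.
have [[S dS cardS] minPsi] := PsiP (@hypercube n).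
have [[S' dS' cardS'] minPsi'] := PsiP (@hypercube n.+1).
apply/andP; split.
  (* The projection may merge vertices, which only lowers the cardinality. *)
  rewrite -cardS'; apply: leq_trans (minPsi _ (doubly_resolving_tail dS')) _.
  exact: leq_imset_card.
have [s sS] := doubly_resolving_neq0 hn dS.
apply: leq_trans (minPsi' _ (doubly_resolving_cons sS dS)) _.
rewrite -cardS cardsU1 (card_imset _ (@cube_cons_inj _ _)).
by rewrite -[X in _ <= X]add1n leq_add2r leq_b1.
Qed.
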